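(* Let $P$ be any real univariate polynomial of degree $n\ge 1$, let $d\ge 1$ be the integer with $2d-1\le n\le 2d$, and write $P$ in the form $$P(x)=q_1(x)P_{2d-1}(x)+q_2(x)P_{2d-3}(x)+\cdots+q_d(x)P_1(x)+R(x),$$ where $q_1,\dots,q_d$ and $R$ are linear polynomials. If $q_d$ is a constant, then $$\int_{-1}^1 P(x)\,dx = 2P(0).$$
   Context: For $m\ge 0$, $P_m$ denotes the Legendre orthogonal polynomial of degree $m$ on $[-1,1]$ normalized to have leading coefficient $1$; that is, the $P_m$ are monic of degree $m$ and pairwise orthogonal with respect to $\int_{-1}^1 f g\,dx$. In the sum, the $i$-th term is $q_i(x)P_{2(d-i)+1}(x)$, $i=1,\dots,d$. ''Linear polynomial'' means a real polynomial of degree at most $1$. *)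

(* Defs.v *)
From HB Require Import structures.
From mathcomp Require Import all_boot all_order all_algebra.
From mathcomp Require Import all_classical all_reals all_analysis.

Set Implicit Arguments.
Unset Strict Implicit.
Unset Printing Implicit Defensive.

Import Order.TTheory GRing.Theory Num.Theory.

Local Open Scope ring_scope.

Definition poly_integral (R : realType) (p : {poly R}) : R :=
  \int[lebesgue_measure]_(x in `[(-1 : R), 1]%classic) p.[x].

(* These conditions determine the family uniquely: [L m] is the Legendre
   polynomial of degree [m], normalized to be monic. *)
Definition is_monic_legendre (R : realType) (L : nat -> {poly R}) : Prop :=
  (forall m, L m \is monic /\ size (L m) = m.+1) /\
  (forall i j, i <> j -> poly_integral (L i * L j) = 0).

(* Affine polynomials: constants, including 0, are allowed. *)
Definition linear_poly (R : realType) (p : {poly R}) : Prop :=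
  (size p <= 2)%N.

(* Only the values [q 1, .., q d] matter. *)
Definition legendre_form (R : realType) (L : nat -> {poly R}) (d : nat)
    (P : {poly R}) (q : nat -> {poly R}) (r : {poly R}) : Prop :=
  [/\ forall i, (1 <= i <= d)%N -> linear_poly (q i),
      linear_poly r
    & P = \sum_(1 <= i < d.+1) q i * L (2 * (d - i) + 1)%N + r].

(* Main.v *)
Require Import Defs.
From HB Require Import structures.
From mathcomp Require Import all_boot all_order all_algebra.
From mathcomp Require Import all_classical all_reals all_analysis.
From mathcomp Require Import zify ring lra.

(** The expansion exists by repeated Euclidean division: a polynomial of
    degree at most 2d, divided by the Legendre polynomial of degree 2d-1, leaves
    a quotient of degree at most 1 and a remainder of degree at most 2(d-1)
    ([legendre_form_exists]).

    For the quadrature identity, only the affine remainder [r] contributes to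
    either side. In the integral, the i-th term is an affine polynomial times a
    Legendre polynomial of degree at least 3 when i < d, and a constant times
    the one of degree 1 when i = d (this is where [q d] has to be constant: the
    integral of 'X * 'X is not zero); each such term vanishes because a Legendre
    polynomial is orthogonal to everything of smaller degree
    ([legendre_orthogonal_lower]). At 0, the Legendre polynomials of odd degree
    vanish because they are odd functions ([legendre_odd_at0]). Finally the
    integral of an affine polynomial over [-1, 1] is twice its value at 0
    ([poly_integral_linear]).

    The parity comes from uniqueness: reflecting the Legendre polynomial of
    degree m preserves its orthogonality to lower degrees, so its difference
    with the suitably signed original has degree below m and is orthogonal to
    itself; it is zero since the inner product is definite
    ([poly_integral_sqr_eq0]).

    Every fact about integrals is derived from the fundamental theorem of
    calculus for polynomials ([poly_integral_deriv]), which turns it into an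
    identity between the values of a primitive at the two end points. *)

Set Implicit Arguments.
Unset Strict Implicit.
Unset Printing Implicit Defensive.

Import Order.TTheory GRing.Theory Num.Theory.
Import numFieldNormedType.Exports.

Local Open Scope ring_scope.

(** * The integral of a polynomial over [-1, 1] *)

Lemma poly_primitive (R : realType) (p : {poly R}) : exists Q, Q^`() = p.
Proof.
exists (\poly_(i < (size p).+1) (p`_i.-1 / i%:R)).
apply/polyP => i; rewrite coef_deriv coef_poly ltnS /=.
case: ltnP => [_|pi]; last by rewrite mul0rn nth_default.
by rewrite -[_ *+ _]mulr_natr divfK ?pnatr_eq0.
Qed.

Lemma poly_integral_deriv (R : realType) (Q : {poly R}) :
  poly_integral Q^`() = Q.[1] - Q.[-1].
Proof.
rewrite /poly_integral /Rintegral
  (@continuous_FTC2 R (horner Q^`()) (horner Q)) //.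
- by apply: continuous_subspaceT; exact: continuous_horner.
- split.
  + by move=> x _; exact: derivable_horner.
  + by apply: cvg_at_right_filter; exact: continuous_horner.
  + by apply: cvg_at_left_filter; exact: continuous_horner.
- by move=> x _; rewrite derivE.
Qed.

Lemma poly_integralD (R : realType) (p q : {poly R}) :
  poly_integral (p + q) = poly_integral p + poly_integral q.
Proof.
have [[P <-] [Q <-]] := (poly_primitive p, poly_primitive q).
by rewrite -derivD !poly_integral_deriv !hornerD; ring.
Qed.

Lemma poly_integralZ (R : realType) (c : R) (p : {poly R}) :
  poly_integral (c *: p) = c * poly_integral p.
Proof.
have [P <-] := poly_primitive p.
by rewrite -derivZ !poly_integral_deriv !hornerZ; ring.
Qed.

Lemma poly_integral0 (R : realType) : poly_integral (0 : {poly R}) = 0.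
Proof. by rewrite -[0 in LHS](scale0r 0) poly_integralZ mul0r. Qed.

Lemma poly_integral_sum (R : realType) (I : Type) (s : seq I)
    (F : I -> {poly R}) :
  poly_integral (\sum_(i <- s) F i) = \sum_(i <- s) poly_integral (F i).
Proof.
exact: (big_morph _ (@poly_integralD R) (@poly_integral0 R)).
Qed.

Lemma poly_integral_reflect (R : realType) (p : {poly R}) :
  poly_integral (p \Po - 'X) = poly_integral p.
Proof.
have [P <-] := poly_primitive p.
have -> : P^`() \Po - 'X = (- (P \Po - 'X))^`().
  by rewrite derivN deriv_comp derivN derivX mulrN1 opprK.
rewrite !poly_integral_deriv !hornerE !horner_comp !hornerE !opprK.
by ring.
Qed.

Lemma poly_integral_linear (R : realType) (r : {poly R}) :
  linear_poly r -> poly_integral r = 2 * r.[0].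
Proof.
move=> r_lin.
have -> : r = r`_0 *: ('X)^`() + (r`_1 / 2) *: ('X^2)^`().
  apply/polyP => i; rewrite derivX derivXn /= !coefE.
  case: i => [|[|i]] /=; rewrite ?eqxx.
  - by rewrite mulr1 mul0rn mulr0 addr0.
  - by rewrite mulr0 add0r divfK ?pnatr_eq0.
  - by rewrite mul0rn !mulr0 addr0 nth_default // (leq_trans r_lin).
rewrite poly_integralD !poly_integralZ !poly_integral_deriv.
by rewrite derivX derivXn !hornerE /=; ring.
Qed.

(** The primitive of [p ^+ 2] is monotone on [-1, 1]; equal values at the ends
    make it constant there, hence constant as a polynomial. *)
Lemma poly_integral_sqr_eq0 (R : realType) (p : {poly R}) :
  poly_integral (p * p) = 0 -> p = 0.
Proof.
have [Q QE] := poly_primitive (p * p); rewrite -QE poly_integral_deriv.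
move=> /subr0_eq Q_ends.
have Q_mono x y : -1 <= x -> x <= y -> y <= 1 -> Q.[x] <= Q.[y].
  apply: (@ger0_derive1_ndecr R (horner Q) (-1) 1).
  - by move=> z _; exact: derivable_horner.
  - by move=> z _; rewrite -derivE QE hornerM -expr2 sqr_ge0.
  - by apply: continuous_subspaceT; exact: continuous_horner.
have Q_cst x : -1 <= x <= 1 -> Q.[x] = Q.[-1].
  move=> /andP[x_ge x_le]; apply/eqP; rewrite eq_le -{1}Q_ends.
  by rewrite !Q_mono // ?lexx //; lra.
have Q0 : Q - Q.[-1]%:P = 0.
  (* Enough distinct roots in the interval: 1, 1/2, 1/3, and so on. *)
  pose s : seq R := [seq i.+1%:R^-1 | i <- iota 0 (size (Q - Q.[-1]%:P))].
  apply: (@roots_geq_poly_eq0 _ _ s).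
  - apply/allP => _ /mapP[i _ ->]; rewrite rootE !hornerE subr_eq0.
    apply/eqP/Q_cst/andP; split.
      by rewrite (@le_trans _ _ 0) ?invr_ge0 ?ler0n //; lra.
    by rewrite invf_le1 ?ler1n ?ltr0n.
  - rewrite map_inj_uniq ?iota_uniq // => i j /invr_inj/eqP.
    by rewrite eqr_nat => /eqP[].
  - by rewrite size_map size_iota.
have /eqP : p * p = 0.
  by rewrite -QE -(subrK Q.[-1]%:P Q) Q0 add0r derivC.
by rewrite mulf_eq0 orbb => /eqP.
Qed.

(** * Orthogonality and parity of the Legendre polynomials *)

(** The Legendre polynomials of degree below [m] span the polynomials of degree
    below [m], as one sees by cancelling leading terms; [L m] is orthogonal to
    each of them. *)
Lemma legendre_orthogonal_lower (R : realType) (L : nat -> {poly R})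
    (hL : is_monic_legendre L) (m : nat) (p : {poly R}) :
  (size p <= m)%N -> poly_integral (p * L m) = 0.
Proof.
have [monicL orthL] := hL.
(* The bound on the size of [p] decreases in the induction while [L m] stays. *)
move: (leqnn m); move: {1 3}m => k; elim: k p => [|k IHk] p km pk.
  move: pk; rewrite leqn0 size_poly_eq0 => /eqP->.
  by rewrite mul0r poly_integral0.
have [/eqP lead1 sizeLk] := monicL k.
have rest_lt : (size (p - p`_k *: L k)%R <= k)%N.
  apply/leq_sizeP => j; rewrite leq_eqVlt coefB coefZ => /predU1P[<-|kj].
    by move: lead1; rewrite lead_coefE sizeLk /= => ->; rewrite mulr1 subrr.
  rewrite (nth_default _ (leq_trans pk kj)) [(L k)`_j]nth_default ?sizeLk //.
  by rewrite mulr0 subrr.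
rewrite -(subrK (p`_k *: L k) p) mulrDl poly_integralD IHk ?(ltnW km) //.
rewrite -scalerAl poly_integralZ orthL ?mulr0 ?addr0 // => km'.
by rewrite km' ltnn in km.
Qed.

(** The difference [D] of the two sides has degree below [m], as their leading
    terms agree. It is orthogonal to every such polynomial, since reflection
    preserves both the integral and the degree; hence [D] is orthogonal to
    itself. *)
Lemma legendre_reflect (R : realType) (L : nat -> {poly R})
    (hL : is_monic_legendre L) (m : nat) :
  L m \Po - 'X = (-1) ^+ m *: L m.
Proof.
have [/eqP lead1 sizeLm] := hL.1 m.
have size_reflect (p : {poly R}) : size (p \Po - 'X) = size p.
  by rewrite size_comp_poly2 // size_polyN size_polyX.
set D := L m \Po - 'X - (-1) ^+ m *: L m.
have D_lt : (size D <= m)%N.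
  apply/leq_sizeP => j; rewrite leq_eqVlt coefB coefZ => /predU1P[<-|mj].
    have := @lead_coef_comp _ (L m) (- 'X).
    rewrite size_polyN size_polyX lead_coefN lead_coefX => /(_ isT).
    rewrite lead1 sizeLm mul1r lead_coefE size_reflect sizeLm /= => ->.
    move: lead1; rewrite lead_coefE sizeLm /= => ->.
    by rewrite mulr1 subrr.
  by rewrite !nth_default ?mulr0 ?subrr ?size_reflect ?sizeLm.
apply/subr0_eq/poly_integral_sqr_eq0; rewrite -/D.
rewrite {2}/D mulrBr poly_integralD -scalerAr -scaleNr poly_integralZ.
rewrite (legendre_orthogonal_lower hL D_lt) mulr0 addr0.
(* Reflecting [D * (L m \Po - 'X)] brings back [L m] against a polynomial of
   the degree of [D]. *)
have XX : - 'X \Po - 'X = 'X :> {poly R}.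
  by rewrite -scaleN1r comp_polyZ comp_polyX scaleN1r scaleN1r opprK.
rewrite -poly_integral_reflect comp_polyM -comp_polyA XX comp_polyXr.
by apply: legendre_orthogonal_lower => //; rewrite size_reflect.
Qed.

Lemma legendre_odd_at0 (R : realType) (L : nat -> {poly R})
    (hL : is_monic_legendre L) (m : nat) : odd m -> (L m).[0] = 0.
Proof.
move=> m_odd; have := congr1 (fun p => p.[0]) (legendre_reflect hL m).
rewrite horner_comp !hornerE oppr0 -signr_odd m_odd expr1 mulN1r => L0.
by lra.
Qed.

(** * Expansion along the odd Legendre polynomials *)

(** Dividing by the Legendre polynomial of highest degree gives the first
    coefficient; those of the remainder, at level [d], become the later ones at
    level [d.+1], shifted by one index. *)
Lemma legendre_form_exists (R : realType) (L : nat -> {poly R})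
    (hL : is_monic_legendre L) (d : nat) (P : {poly R}) :
  (size P <= (2 * d).+1)%N -> exists q r, legendre_form L d P q r.
Proof.
elim: d P => [|d IHd] P sizeP.
  exists (fun=> 0), P; split=> [i||]; first by case: i.
    by apply: leq_trans sizeP _.
  by rewrite big_geq // add0r.
have [monicL sizeL] := hL.1 (2 * d + 1)%N.
have Lneq0 := monic_neq0 monicL.
have [|q [r [q_lin r_lin rem_eq]]] := IHd (P %% L (2 * d + 1)%N).
  by have := ltn_modpN0 P Lneq0; rewrite sizeL ltnS addn1.
exists (fun i => if i is j.+2 then q j.+1 else P %/ L (2 * d + 1)%N), r.
split=> // [[|[|i]] /andP[i_gt0 i_le] //|].
- by rewrite /linear_poly size_divp // sizeL leq_subLR (leq_trans sizeP) //; lia.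
- exact: q_lin.
rewrite big_nat_recl // subn1 /=.
rewrite [LHS](Pdiv.IdomainMonic.divp_eq monicL) -addrA; congr (_ + _).
rewrite [LHS]rem_eq; congr (_ + _).
by apply: eq_big_nat => -[|i] // _; rewrite subSS.
Qed.

Theorem theorem2p1 (R : realType) (L : nat -> {poly R})
    (hL : is_monic_legendre L) (n d : nat) (P : {poly R})
    (hn : (1 <= n)%N) (hP : size P = n.+1)
    (hd : (1 <= d)%N) (hnd : (2 * d - 1 <= n <= 2 * d)%N) :
  (exists (q : nat -> {poly R}) (r : {poly R}), legendre_form L d P q r) /\
  (forall (q : nat -> {poly R}) (r : {poly R}),
     legendre_form L d P q r -> (size (q d) <= 1)%N ->
     \int[lebesgue_measure]_(x in `[(-1 : R), 1]%classic) P.[x] = 2 * P.[0]).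
Proof.
split.
  by apply: legendre_form_exists => //; rewrite hP; case/andP: hnd.
move=> q r [q_lin r_lin ->] qd_cst; rewrite -/(poly_integral _).
rewrite poly_integralD poly_integral_sum hornerD horner_sum.
rewrite [X in X + _]big_nat [X in X + _]big1 => [|i /andP[i_gt0 i_le]].
  rewrite add0r big_nat [X in _ = 2 * (X + _)]big1 => [|i /andP[i_gt0 i_le]].
    by rewrite add0r; exact: poly_integral_linear.
  rewrite hornerM (legendre_odd_at0 hL) ?mulr0 //.
  by rewrite oddD oddM.
(* [q i] has degree below 2 (d - i) + 1: the case [i = d] rests on [q d] being
   constant, the others on [q i] being affine. *)
apply: legendre_orthogonal_lower => //.
move: i_le; rewrite ltnS leq_eqVlt => /predU1P[->|i_lt].
  by rewrite subnn muln0.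
by apply: leq_trans (q_lin i _) _; lia.
Qed.
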